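(* Let $K$ be a compact Hausdorff space, $\phi:K\to K$ a continuous map, and $t\in K$ a point whose orbit contains a periodic point; let $t'=\phi^{n_0}(t)$ be the first periodic element of the orbit of $t$, with period $p$. Then the algebra $\mathcal{C}_t$ is the linear sum $$(\mathfrak{T}P_{n_0})\oplus(\mathcal{T}P_0)\oplus\cdots\oplus(\mathcal{T}P_{p-1}),$$ where $\mathfrak{T}$ is the algebra of lower triangular operators in $\mathcal{B}(\ell^2(\mathbb{Z}_+))$, $\mathcal{T}$ is the algebra of analytic Toeplitz operators, and $P_{n_0},P_0,\dots,P_{p-1}$ are the projections induced by the orbit of $t$.
   Context: Let $\mathbb{Z}_+=\{0,1,2,\dots\}$, $(e_n)_{n\ge0}$ the standard basis of $\ell^2(\mathbb{Z}_+)$, $p_n$ the projection onto $\mathbb{C}e_n$, $v$ the unilateral shift $ve_n=e_{n+1}$. For $f\in C(K)$ let $\pi_t(f)=\sum_{n\ge0}f(\phi^n(t))p_n\in\mathcal{B}(\ell^2(\mathbb{Z}_+))$. The algebra $\mathcal{C}_t$ (one point w*-semicrossed product) is the w*-closed linear span in $\mathcal{B}(\ell^2(\mathbb{Z}_+))$ of the operators $\sum_{n=0}^kv^n\pi_t(f_n)$, $f_n\in C(K)$, $k\ge0$. Here $n_0\ge0$ is the least integer such that $\phi^{n_0}(t)$ is a periodic point of $\phi$ and $p\ge1$ is its (least) period, so $\mathrm{orb}(t)=\{t,\dots,\phi^{n_0-1}(t),t',\phi(t'),\dots,\phi^{p-1}(t')\}$. $P_{n_0}$ denotes the projection onto $[e_0,\dots,e_{n_0-1}]$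 (zero if $n_0=0$), and for $i=0,\dots,p-1$, $P_i$ denotes the projection onto the closed span $[e_{n_0+i+pj}:j\in\mathbb{Z}_+]$; the symbol $P_{n_0}$ is always the former projection, even if $n_0\in\{0,\dots,p-1\}$. These projections are mutually orthogonal with sum $I$. Lower triangular means $\langle Te_\lambda,e_\kappa\rangle=0$ whenever $\kappa<\lambda$. $\mathcal{T}$ is the w*-closed algebra generated by $v$ and $I$. The linear sum is the set of all operators $A P_{n_0}+\sum_{i=0}^{p-1}B_iP_i$ with $A\in\mathfrak{T}$, $B_i\in\mathcal{T}$. *)

(* Defs.v *)
From HB Require Import structures.
From mathcomp Require Import all_boot all_order all_algebra.
From mathcomp Require Import complex.
From mathcomp Require Import all_classical all_reals all_analysis.
From mathcomp Require Import ring.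

Set Implicit Arguments.
Unset Strict Implicit.
Unset Printing Implicit Defensive.

Import Order.TTheory GRing.Theory Num.Theory numFieldNormedType.Exports.
Import Normc.

Local Open Scope classical_set_scope.
Local Open Scope complex_scope.
Local Open Scope ring_scope.

(* MathComp-Analysis puts the norm topology on R[i]^o only. *)
HB.instance Definition _ (R : realType) := GRing.ComAlgebra.copy R[i] R[i]^o.
HB.instance Definition _ (R : realType) := Vector.copy R[i] R[i]^o.
HB.instance Definition _ (R : realType) := NormedModule.copy R[i] R[i]^o.

Section SquareSummable.
Context {R : realType}.
Implicit Types x y : nat -> R[i].

Definition sqsum x : \bar R := (\sum_(n <oo) (normc (x n) ^+ 2)%:E)%E.

Definition square_summable : {pred nat -> R[i]} :=
  mem [set x | (sqsum x < +oo)%E].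

Lemma sqsum_ge0 x : (0 <= sqsum x)%E.
Proof. by apply: nneseries_ge0 => n _ _; rewrite lee_fin sqr_ge0. Qed.

Lemma normc_ge0 (z : R[i]) : 0 <= normc z.
Proof. by case: z => a b /=; rewrite sqrtr_ge0. Qed.

Lemma sqsum_le (c : R) x y : 0 <= c ->
  (forall n, normc (y n) <= c * normc (x n)) ->
  (sqsum y <= (c ^+ 2)%:E * sqsum x)%E.
Proof.
move=> c0 xy; rewrite /sqsum -nneseriesZl; last first.
  by move=> n _; rewrite lee_fin sqr_ge0.
apply: lee_nneseries => n _; first by move=> _; rewrite lee_fin sqr_ge0.
by rewrite -EFinM lee_fin -exprMn lerXn2r ?nnegrE ?mulr_ge0 ?normc_ge0.
Qed.

(* (a + b)^2 <= (s + t)(a^2/s + b^2/t) *)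
Lemma sqsumD_le (s t : R) x y : 0 < s -> 0 < t ->
  (sqsum (x + y)%R <= ((s + t) / s)%:E * sqsum x + ((s + t) / t)%:E * sqsum y)%E.
Proof.
move=> s0 t0; have st0 : 0 < s + t by rewrite addr_gt0.
rewrite /sqsum -!nneseriesZl; try by move=> n _; rewrite lee_fin sqr_ge0.
rewrite -nneseriesD; last 2 first.
  by move=> n _ _; rewrite -EFinM lee_fin mulr_ge0 ?sqr_ge0 ?divr_ge0 ?ltW.
  by move=> n _ _; rewrite -EFinM lee_fin mulr_ge0 ?sqr_ge0 ?divr_ge0 ?ltW.
apply: lee_nneseries => n _; first by move=> _; rewrite lee_fin sqr_ge0.
rewrite -!EFinM -EFinD lee_fin.
set a := normc (x n); set b := normc (y n).
apply: (@le_trans _ _ ((a + b) ^+ 2)).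
  by rewrite lerXn2r ?nnegrE ?addr_ge0 ?normc_ge0// le_normcD.
rewrite -subr_ge0.
have -> : (s + t) / s * a ^+ 2 + (s + t) / t * b ^+ 2 - (a + b) ^+ 2 =
    (s * t)^-1 * (t * a - s * b) ^+ 2.
  by field; rewrite !gt_eqF.
by rewrite mulr_ge0 ?sqr_ge0// invr_ge0 mulr_ge0 ?ltW.
Qed.

Lemma square_summable_submod : submod_closed square_summable.
Proof.
split=> [|a x y].
  rewrite inE /= /sqsum eseries0 ?ltry// => n _ _.
  by rewrite (_ : normc _ = 0) ?expr0n//; exact: normc0.
rewrite !inE /= => xs ys.
apply: (le_lt_trans (sqsumD_le _ _ ltr01 ltr01)).
apply: lte_add_pinfty; apply: lte_mul_pinfty => //.
apply: (@le_lt_trans _ _ ((normc a ^+ 2)%:E * sqsum x)%E).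
  apply: sqsum_le; first exact: normc_ge0.
  by move=> n; rewrite -normcM.
by apply: lte_mul_pinfty => //; rewrite lee_fin sqr_ge0.
Qed.

HB.instance Definition _ := GRing.isSubmodClosed.Build R[i] (nat -> R[i])
  square_summable square_summable_submod.

End SquareSummable.


Section L2.
Context (R : realType).

Record l2 := L2 { l2_seq :> nat -> R[i]; l2_seqP : l2_seq \in square_summable }.

HB.instance Definition _ := [isSub for l2_seq].
HB.instance Definition _ := [Choice of l2 by <:].
HB.instance Definition _ := [SubChoice_isSubLmodule of l2 by <:].

Implicit Types x y : l2.

Lemma l2P x y : x =1 y -> x = y.
Proof. by move=> xy; apply/val_inj/funext. Qed.

Lemma l2D x y n : (x + y) n = x n + y n. Proof. by []. Qed.

Lemma l2Z a x n : (a *: x) n = a * x n. Proof. by []. Qed.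

Definition l2norm x : R := Num.sqrt (fine (sqsum x)).

Lemma sqsum_fin x : (sqsum x)%E \is a fin_num.
Proof.
by have := l2_seqP x; rewrite inE /= => h; rewrite ge0_fin_numE// sqsum_ge0.
Qed.

Lemma sqr_l2norm x : sqsum x = (l2norm x ^+ 2)%:E.
Proof. by rewrite sqr_sqrtr ?fine_ge0 ?sqsum_ge0// fineK// sqsum_fin. Qed.

Lemma l2norm_ge0 x : 0 <= l2norm x. Proof. exact: sqrtr_ge0. Qed.

Lemma l2norm_le (c : R) x y : 0 <= c -> (sqsum x <= (c ^+ 2)%:E * sqsum y)%E ->
  l2norm x <= c * l2norm y.
Proof.
move=> c0; rewrite !sqr_l2norm -EFinM lee_fin -exprMn.
by rewrite ler_pXn2r ?nnegrE ?mulr_ge0 ?l2norm_ge0.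
Qed.

Lemma normc_le_l2norm x n : normc (x n) <= l2norm x.
Proof.
rewrite -(@ler_pXn2r _ 2) ?nnegrE ?l2norm_ge0 ?normc_ge0// -lee_fin.
rewrite -sqr_l2norm /sqsum.
have f0 i : (0 <= (normc (x i) ^+ 2)%:E)%E by rewrite lee_fin sqr_ge0.
apply: le_trans (nneseries_lim_ge n.+1 _) => //.
by rewrite big_nat_recr//= leeDr// sume_ge0.
Qed.

Lemma l2norm0_eq0 x : l2norm x = 0 -> x = 0.
Proof.
move=> x0; apply: l2P => n; apply: eq0_normc; apply: le_anti.
by rewrite normc_ge0 -x0 normc_le_l2norm.
Qed.

Lemma l2normD x y : l2norm (x + y) <= l2norm x + l2norm y.
Proof.
have := l2norm_ge0 x; rewrite le_eqVlt => /orP[/eqP/esym x0|x0].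
  by rewrite (l2norm0_eq0 x0) add0r lerDr l2norm_ge0.
have := l2norm_ge0 y; rewrite le_eqVlt => /orP[/eqP/esym y0|y0].
  by rewrite (l2norm0_eq0 y0) addr0 lerDl l2norm_ge0.
rewrite -(@ler_pXn2r _ 2) ?nnegrE ?addr_ge0 ?l2norm_ge0// -lee_fin.
rewrite -sqr_l2norm; apply: le_trans (sqsumD_le x y x0 y0) _.
rewrite !sqr_l2norm -!EFinM -EFinD lee_fin le_eqVlt; apply/orP; left.
by apply/eqP; field; rewrite !gt_eqF.
Qed.

Lemma normcR (z : R[i]) : `|z| = (normc z)%:C. Proof. by case: z. Qed.

Lemma l2normZ a x : l2norm (a *: x) = normc a * l2norm x.
Proof.
have le b z : l2norm (b *: z) <= normc b * l2norm z.
  apply: l2norm_le; first exact: normc_ge0.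
  by apply: sqsum_le => [|n]; [exact: normc_ge0|rewrite -normcM].
have [->|a0] := eqVneq a 0.
  apply: le_anti; rewrite le (_ : normc 0 = 0); last exact: normc0.
  by rewrite mul0r l2norm_ge0.
apply: le_anti; rewrite le/= -ler_pdivlMl; last first.
  by rewrite lt_def normc_ge0 andbT; apply: contra_neq a0; exact: eq0_normc.
by rewrite -normcV (le_trans _ (le _ _))// scalerA mulVf// scale1r.
Qed.

Lemma l2norm_lerD x y : (l2norm (x + y))%:C <= (l2norm x)%:C + (l2norm y)%:C.
Proof. by rewrite -rmorphD lecR l2normD. Qed.

Lemma l2norm_normrZ (a : R[i]) x : (l2norm (a *: x))%:C = `|a| * (l2norm x)%:C.
Proof. by rewrite l2normZ normcR -rmorphM. Qed.

Lemma l2norm_normr0_eq0 x : (l2norm x)%:C = 0 :> R[i] -> x = 0.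
Proof. by move=> -[/l2norm0_eq0]. Qed.

HB.instance Definition _ := Lmodule_isNormed.Build R[i] l2
  l2norm_lerD l2norm_normrZ l2norm_normr0_eq0.

Lemma l2_normE x : `|x| = (l2norm x)%:C. Proof. by []. Qed.

End L2.

Section BoundedOperators.
Context (R : realType).
Local Notation l2 := (l2 R).

Definition bounded_operator : {pred l2 -> l2} :=
  mem [set T : l2 -> l2 | linear T /\ continuous T].

Lemma bounded_operator_submod : submod_closed bounded_operator.
Proof.
split=> [|a S T].
  rewrite inE; split=> [b x y|]; last exact: cst_continuous.
  by rewrite /= scaler0 addr0.
rewrite !inE /= => -[lS cS] [lT cT]; split=> [b x y|x].
  have E z : (a *: S + T) z = a *: S z + T z by [].
  by rewrite !E lS lT !scalerDr !scalerA (mulrC b) addrACA.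
exact: cvgD (cvgZl_tmp (cS x)) (cT x).
Qed.

HB.instance Definition _ := GRing.isSubmodClosed.Build R[i] (l2 -> l2)
  bounded_operator bounded_operator_submod.

Record bop := Bop { bop_fun :> l2 -> l2; bop_funP : bop_fun \in bounded_operator }.

HB.instance Definition _ := [isSub for bop_fun].
HB.instance Definition _ := [Choice of bop by <:].
HB.instance Definition _ := [SubChoice_isSubLmodule of bop by <:].

Implicit Types S T : bop.

Lemma bopP S T : S =1 T -> S = T.
Proof. by move=> ST; apply/val_inj/funext. Qed.

Lemma bop_linear T : linear T.
Proof. by have := bop_funP T; rewrite inE => -[]. Qed.

Lemma bop_continuous T : continuous T.
Proof. by have := bop_funP T; rewrite inE => -[]. Qed.

HB.instance Definition _ T :=
  GRing.isLinear.Build R[i] l2 l2 _ (bop_fun T) (bop_linear T).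

Lemma bop_id_subproof : @idfun l2 \in bounded_operator.
Proof. by rewrite inE; split=> [a x y //|x]; exact: cvg_id. Qed.

Definition bop_id := Bop bop_id_subproof.

Lemma bop_comp_subproof S T : S \o T \in bounded_operator.
Proof.
rewrite inE; split=> [a x y|x]; first by rewrite /= !linearP.
by apply: continuous_comp; exact: bop_continuous.
Qed.

Definition bop_comp S T := Bop (bop_comp_subproof S T).

Lemma bop_compA : associative bop_comp. Proof. by move=> *; exact: bopP. Qed.
Lemma bop_comp1l : left_id bop_id bop_comp. Proof. by move=> *; exact: bopP. Qed.
Lemma bop_comp1r : right_id bop_id bop_comp. Proof. by move=> *; exact: bopP. Qed.
Lemma bop_compDl : left_distributive bop_comp +%R.
Proof. by move=> *; exact: bopP. Qed.
Lemma bop_compDr : right_distributive bop_comp +%R.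
Proof. by move=> S T U; apply: bopP => x; rewrite /= linearD. Qed.

HB.instance Definition _ := GRing.Zmodule_isPzRing.Build bop
  bop_compA bop_comp1l bop_comp1r bop_compDl bop_compDr.

(* A linear map with operator norm at most c. *)
Lemma bounded_operator_of (c : R) (T : l2 -> l2) : linear T ->
  (forall x, l2norm (T x) <= c * l2norm x) -> T \in bounded_operator.
Proof.
move=> lT Tc; rewrite inE; split => //.
pose h := GRing.isLinear.Build R[i] l2 l2 _ T lT.
pose T' : {linear l2 -> l2} := HB.pack T h.
apply: (bounded_linear_continuous (f := T')).
apply/linear_boundedP; near=> r => x.
rewrite (@le_trans _ _ (c%:C * `|x|))//.
  by rewrite l2_normE -rmorphM lecR.
rewrite ler_wpM2r//; near: r; apply: nbhs_pinfty_ge.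
by rewrite realE !lecE /= eqxx -realE num_real.
Unshelve. all: by end_near. Qed.

End BoundedOperators.

Section Operators.
Context (R : realType).
Local Notation l2 := (l2 R).
Local Notation bop := (bop R).

(* Linear in the first variable. *)
Definition inner (x y : l2) : R[i] :=
  limn (series (fun n => x n * (y n)^*)).

Lemma l2_basis_subproof (k : nat) :
  (fun n => (n == k)%:R) \in @square_summable R.
Proof.
rewrite inE /= /sqsum (nneseries_split 0 k.+1); last first.
  by move=> n _; rewrite lee_fin sqr_ge0.
rewrite add0n eseries0 ?adde0; first by rewrite sumEFin ltry.
move=> n kn _; rewrite gtn_eqF// (_ : normc _ = 0) ?expr0n//.
exact: normc0.
Qed.

Definition l2_basis k : l2 := L2 (l2_basis_subproof k).

Lemma sqsum_shift (x : nat -> R[i]) :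
  sqsum (fun n => if n is m.+1 then x m else 0) = sqsum x.
Proof.
rewrite /sqsum nneseries_recl//; last by move=> n _; rewrite lee_fin sqr_ge0.
rewrite -(@nneseries_addn _ _ 1); last by move=> n; rewrite lee_fin sqr_ge0.
rewrite (_ : normc _ = 0); last exact: normc0.
rewrite expr0n add0e; apply: eq_eseriesr => n _.
by rewrite addn1.
Qed.

Lemma shift_subproof (x : l2) :
  (fun n => if n is m.+1 then x m else 0) \in @square_summable R.
Proof. by have := l2_seqP x; rewrite !inE /= sqsum_shift. Qed.

Lemma shift_op_subproof :
  (fun x => L2 (shift_subproof x)) \in @bounded_operator R.
Proof.
apply: (@bounded_operator_of _ 1) => [a x y|x].
  by apply: l2P => -[|n]//; rewrite l2D l2Z /= mulr0 addr0.
by rewrite mul1r /l2norm sqsum_shift.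
Qed.

Definition shift_op : bop := Bop shift_op_subproof.

Section Diagonal.
Variables (d : nat -> R[i]) (hd : bounded_fun d).

Lemma diag_bound : exists2 c : R, 0 <= c & forall n, normc (d n) <= c.
Proof.
have /pinfty_ex_gt0 [M _ dM] := hd.
have h n : normc (d n) <= complex.Re M.
  by have := dM n Logic.I; rewrite /= normcR lecE => /andP[].
by exists (complex.Re M) => //; exact: le_trans (normc_ge0 _) (h 0%N).
Qed.

Lemma diag_subproof (x : l2) : (fun n => d n * x n) \in @square_summable R.
Proof.
have [c c0 dc] := diag_bound; have := l2_seqP x; rewrite !inE /= => xs.
apply: (@le_lt_trans _ _ ((c ^+ 2)%:E * sqsum x)%E).
  by apply: sqsum_le => // n; rewrite normcM ler_wpM2r ?normc_ge0.
by apply: lte_mul_pinfty => //; rewrite lee_fin sqr_ge0.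
Qed.

Lemma diag_op_subproof :
  (fun x => L2 (diag_subproof x)) \in @bounded_operator R.
Proof.
have [c c0 dc] := diag_bound.
apply: (@bounded_operator_of _ c) => [a x y|x].
  by apply: l2P => n; rewrite l2D l2Z /= mulrDr mulrCA.
apply: l2norm_le => //.
by apply: sqsum_le => // n; rewrite normcM ler_wpM2r ?normc_ge0.
Qed.

(* The strongly convergent sum of the operators d_n p_n, where p_n is the
   projection onto the line spanned by e_n. *)
Definition diag_op : bop := Bop diag_op_subproof.

End Diagonal.

Lemma indic_bounded (A : set nat) : bounded_fun (\1_A : nat -> R[i]).
Proof.
apply/(@ex_bound _ _ _ _ _ (globally_properfilter (I : setT 0%N))).
exists 1 => n _ /=.
by rewrite indicE; case: (_ \in _); rewrite ?normr1 ?normr0.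
Qed.

(* The orthogonal projection onto the closed span of {e_n : n in A}. *)
Definition coord_proj (A : set nat) : bop := diag_op (@indic_bounded A).

End Operators.

Section WeakStar.
Context (R : realType).

(* Sequences (x_k) in l2 with \sum_k |x_k|^2 < +oo. *)
Definition square_summable_family :=
  {x : nat -> l2 R | (\sum_(k <oo) (l2norm (x k) ^+ 2)%:E < +oo)%E}.

(* The normal functionals T |-> \sum_k <T x_k, y_k>; they are exactly the
   elements of the predual of B(l2), the trace class operators. *)
Definition normal_functional
    (w : square_summable_family * square_summable_family) (T : bop R) : R[i] :=
  limn (series (fun k => inner (T (sval w.1 k)) (sval w.2 k))).

Definition normal_functionals (T : bop R) :
    {ptws square_summable_family * square_summable_family -> R[i]} :=
  fun w => normal_functional w T.

(* bop R carries the w*-topology, not the norm topology. *)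
HB.instance Definition _ :=
  Topological.copy (bop R) (initial_topology normal_functionals).

End WeakStar.

Section OperatorAlgebras.
Context (R : realType).
Implicit Types (A B G : set (bop R)) (T : bop R).

Definition subspace_set A := submod_closed (mem A).

Definition subalgebra_set A := subspace_set A /\ GRing.mulr_2closed (mem A).

Definition wstar_closed_span G := closure (smallest subspace_set G).

Definition wstar_closed_algebra G :=
  smallest [set A | subalgebra_set A /\ closed A] G.

Definition lower_triangular : set (bop R) :=
  [set T : bop R | forall k l : nat, (k < l)%N ->
    inner (T (l2_basis R l)) (l2_basis R k) = 0].

Definition analytic_toeplitz : set (bop R) :=
  wstar_closed_algebra [set shift_op R; 1].

End OperatorAlgebras.

Arguments lower_triangular R : clear implicits.
Arguments analytic_toeplitz R : clear implicits.

Lemma normc_continuous (R : realType) : continuous (@normc R : R[i] -> R).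
Proof.
have le (z w : R[i]) : normc z - normc w <= normc (z - w).
  by rewrite lerBlDr -[in leLHS](subrK w z) le_normcD.
move=> z; apply/(@cvgrPdist_lt _ _ _ (nbhs z)) => e e0; near=> w.
rewrite -ltcR; apply: (@le_lt_trans _ _ `|z - w|).
  rewrite normcR lecR ler_norml le andbT lerNl opprB.
  by rewrite (le_trans (le _ _))// -opprB normcN.
by near: w; apply/nbhs_normP; exists e%:C => //=; rewrite ltcR.
Unshelve. all: by end_near. Qed.

Lemma compact_bounded_fun (R : realType) (K : topologicalType) (f : K -> R[i]) :
  compact [set: K] -> continuous f ->
  exists M : R, forall x, normc (f x) <= M.
Proof.
move=> cK cf.
have cnf : continuous (@normc R \o f).
  by move=> x; apply: continuous_comp; [exact: cf|exact: normc_continuous].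
have /compact_bounded/pinfty_ex_gt0 [M _ fM] :=
  continuous_compact (continuous_subspaceT cnf) cK.
exists M => x; have /= := fM (normc (f x)).
by rewrite ger0_norm ?normc_ge0//; apply; exists x.
Qed.

Section SemicrossedProduct.
Context (R : realType) (K : topologicalType) (cK : compact [set: K]).
Variables (phi : K -> K) (t : K).

Lemma orbit_bounded (f : continuousType K R[i]) :
  bounded_fun (fun n => f (iter n phi t)).
Proof.
have [M fM] := compact_bounded_fun cK (@cts_fun _ _ f).
apply/(@ex_bound _ _ _ _ _ (globally_properfilter (I : setT 0%N))).
by exists M%:C => n _ /=; rewrite normcR lecR.
Qed.

Definition orbit_rep (f : continuousType K R[i]) : bop R :=
  diag_op (orbit_bounded f).

Definition semicrossed_poly (k : nat) (f : nat -> continuousType K R[i]) :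
    bop R :=
  \sum_(n < k.+1) shift_op R ^+ n * orbit_rep (f n).

Definition one_point_semicrossed_product : set (bop R) :=
  wstar_closed_span
    [set T | exists k, exists f, T = semicrossed_poly k f].

End SemicrossedProduct.

Arguments one_point_semicrossed_product R {K} cK phi t.

Section Orbits.
Variables (K : Type) (phi : K -> K).

Definition least (P : nat -> Prop) (n : nat) :=
  P n /\ forall m, P m -> (n <= m)%N.

Definition returns (x : K) (q : nat) := (0 < q)%N /\ iter q phi x = x.

Definition periodic_point (x : K) := exists q, returns x q.

Definition preperiod (t : K) (n0 : nat) :=
  least (fun n => periodic_point (iter n phi t)) n0.

Definition period (x : K) (p : nat) := least (returns x) p.

End Orbits.

Section LinearSum.
Context (R : realType) (n0 p : nat).

Definition proj_pre : bop R := coord_proj R [set n | (n < n0)%N].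

Definition proj_per (i : nat) : bop R :=
  coord_proj R [set (n0 + i + p * j)%N | j in [set: nat]].

Definition sum_op (A : bop R) (B : 'I_p -> bop R) : bop R :=
  A * proj_pre + \sum_(i < p) B i * proj_per i.

Definition linear_sum (X Y : set (bop R)) : set (bop R) :=
  [set T | exists A, exists B, [/\ X A, forall i, Y (B i) & T = sum_op A B]].

Definition direct_sum (X Y : set (bop R)) :=
  forall A B, X A -> (forall i, Y (B i)) -> sum_op A B = 0 ->
    A * proj_pre = 0 /\ forall i : 'I_p, B i * proj_per i = 0.

End LinearSum.

(* Main.v *)
(* An operator T lies in the linear sum iff its matrix is lower triangular and
   T_(k+p, l+p) = T_(k, l) for all l >= n0; these conditions only involve matrix
   entries, so they define a w*-closed subspace, which contains the generators
   of the semicrossed product because phi^(l+p)(t) = phi^l(t) for l >= n0.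
   Conversely, for lower triangular T the N-th Fejer mean, with entries
   (1 - (k-l)/N)^+ T_(k, l), is 1/N times the sum over s of the compressions of T
   to the windows [s-N+1, s]; it has norm at most |T| and tends to T coordinatewise,
   hence in the w*-topology.  It is a polynomial in the shift with diagonal
   coefficients, which are eventually p-periodic when T is, hence of the form
   pi_t(f) because the orbit is finite and K is normal.  The same means show that
   every operator commuting with the shift is an analytic Toeplitz operator. *)

From HB Require Import structures.
From mathcomp Require Import all_boot all_order all_algebra.
From mathcomp Require Import complex.
From mathcomp Require Import all_classical all_reals all_analysis.
From mathcomp Require Import ring lra zify.
Import Order.TTheory GRing.Theory Num.Theory numFieldNormedType.Exports.
Import Normc.
Require Import Defs.

Set Implicit Arguments.
Unset Strict Implicit.
Unset Printing Implicit Defensive.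

Local Open Scope classical_set_scope.
Local Open Scope complex_scope.
Local Open Scope ring_scope.

(** * Absolutely convergent complex series *)
Section ComplexSeries.
Context {R : realType}.
Implicit Types (z w : R[i]) (u v : nat -> R[i]).

(** The norm of [R[i]] is itself complex-valued, and a positive epsilon there is a complex number
    with zero imaginary part. Passing to [normc] makes real squeeze and order arguments
    available. *)
Lemma cvg_normc (T : Type) (F : set_system T) (FF : Filter F) (f : T -> R[i]) z :
  (f x @[x --> F] --> z) <-> (normc (f x - z) @[x --> F] --> (0 : R)).
Proof.
split=> [/(@cvgrPdist_lt _ _ _ F) fz|/(@cvgrPdist_lt _ _ _ F) fz].
  apply/(@cvgrPdist_lt _ _ _ F) => e e0.
  have := fz e%:C; rewrite ltcR => /(_ e0); apply: filterS => x.
  rewrite distrC normcR ltcR sub0r normrN.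
  by rewrite [X in _ -> X < _]ger0_norm// normc_ge0.
apply/(@cvgrPdist_lt _ _ _ F) => -[a b]; rewrite ltcE /= => /andP[/eqP -> a0].
apply: filterS (fz a a0) => x.
rewrite sub0r normrN ger0_norm ?normc_ge0// => h.
by rewrite distrC normcR ltcE /= eqxx.
Qed.

Lemma cvg_normc_le (u : nat -> R[i]) z (e : nat -> R) :
  (forall n, normc (u n - z) <= e n) -> e n @[n --> \oo] --> (0 : R) ->
  u n @[n --> \oo] --> z.
Proof.
move=> ue e0; apply/cvg_normc.
by apply: (squeeze_cvgr _ (cvg_cst 0) e0); near=> n; rewrite normc_ge0 ue.
Unshelve. all: by end_near. Qed.

Lemma normc_Re z : `|complex.Re z| <= normc z.
Proof. by have := normc_ge_Re z; rewrite normcR lecR. Qed.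

Lemma normc_Im z : `|complex.Im z| <= normc z.
Proof.
by case: z => a b /=; rewrite -sqrtr_sqr ler_wsqrtr// lerDr sqr_ge0.
Qed.

Lemma normc_real (a : R) : normc a%:C = `|a|.
Proof. by rewrite /= expr0n addr0 sqrtr_sqr. Qed.

Lemma normc_sum (I : Type) (r : seq I) (P : pred I) (F : I -> R[i]) :
  normc (\sum_(i <- r | P i) F i) <= \sum_(i <- r | P i) normc (F i).
Proof.
elim/big_ind2: _ => [|x1 x2 y1 y2 h1 h2|i _//].
  by rewrite (_ : normc _ = 0)//; exact: normc0.
by rewrite (le_trans (le_normcD _ _))// lerD.
Qed.

Definition csum u : R[i] := limn (series u).

Lemma cvg_csum u : (\sum_(n <oo) (normc (u n))%:E < +oo)%E ->
  series u n @[n --> \oo] --> csum u.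
Proof.
move=> uoo.
(* Applied below to the real and imaginary parts, both dominated termwise by the modulus. *)
have cv (f : nat -> R) : (forall n, `|f n| <= normc (u n)) -> cvgn (series f).
  move=> fu; apply: normed_cvg.
  have := @series_le_cvg R (fun n => `|f n|) (fun n => normc (u n)).
  apply => // [n|].
    exact: normc_ge0.
  apply: nondecreasing_is_cvgn.
    by apply: nondecreasing_series => n _ _; exact: normc_ge0.
  exists (fine (\sum_(n <oo) (normc (u n))%:E)%E) => _ [n _ <-].
  rewrite -lee_fin fineK; last first.
    by rewrite ge0_fin_numE// nneseries_ge0// => k _ _; rewrite lee_fin normc_ge0.
  rewrite /series /= -sumEFin.
  by apply: nneseries_lim_ge => k _; rewrite lee_fin normc_ge0.
have /cv ca n := normc_Re (u n).
have /cv cb n := normc_Im (u n).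
suff : series u n @[n --> \oo] -->
    (limn (series (@complex.Re R \o u)) +i* limn (series (@complex.Im R \o u))).
  by move=> h; apply/cvg_ex; eexists; exact: h.
apply: (@cvg_normc_le _ _ (fun n =>
  `|series (@complex.Re R \o u) n - limn (series (@complex.Re R \o u))| +
  `|series (@complex.Im R \o u) n - limn (series (@complex.Im R \o u))|)) => [n|].
  set a := limn _; set b := limn _.
  have -> : series u n = series (@complex.Re R \o u) n +i* series (@complex.Im R \o u) n.
    rewrite /series /=.
    by elim/big_ind3: _ => // [? ? ? ? ? ? -> -> //|i _]; case: (u i).
  set x := series _ n; set y := series _ n.
  have -> : (x +i* y) - (a +i* b) = (x - a)%:C + (0 +i* (y - b)) :> R[i].
    by apply/eqP; rewrite eq_complex /= !addr0 add0r !eqxx.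
  apply: le_trans (le_normcD _ _) _.
  by rewrite normc_real /= expr0n add0r sqrtr_sqr.
rewrite -[X in _ --> X](addr0 0); apply: cvgD.
  by rewrite -(normr0 R); apply: cvg_norm; apply/subr_cvg0.
by rewrite -(normr0 R); apply: cvg_norm; apply/subr_cvg0.
Qed.

Lemma csumB u v : (\sum_(n <oo) (normc (u n))%:E < +oo)%E ->
  (\sum_(n <oo) (normc (v n))%:E < +oo)%E ->
  csum (u - v) = csum u - csum v.
Proof.
move=> /cvg_csum uc /cvg_csum vc.
have h : series (u - v) n @[n --> \oo] --> csum u - csum v.
  under eq_fun => n do rewrite (_ : series (u - v) n = series u n - series v n)
    ?[LHS]sumrB//.
  exact: (cvgB uc vc).
exact: (cvg_lim (@norm_hausdorff _ R[i]) h).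
Qed.

Lemma csum_tail u m (e : R) : (\sum_(n <oo) (normc (u n))%:E < +oo)%E ->
  (\sum_(m <= n <oo) (normc (u n))%:E <= e%:E)%E ->
  normc (csum u - series u m) <= e.
Proof.
move=> uoo ue.
have h : normc (series u n - series u m) @[n --> \oo] -->
    normc (csum u - series u m).
  apply: (@cvg_comp _ _ _ (fun n => series u n - series u m) (@normc R)
    _ (nbhs (csum u - series u m))).
    by apply: cvgB; [exact: cvg_csum|exact: cvg_cst].
  exact: normc_continuous.
rewrite -(cvg_lim (@norm_hausdorff _ R) h).
apply: limr_le; first by apply/cvg_ex; eexists; exact: h.
near=> n; have mn : (m <= n)%N by near: n; exact: nbhs_infty_ge.
rewrite sub_series_geq//.
apply: le_trans (normc_sum _ _ _) _.
rewrite -lee_fin -sumEFin; apply: le_trans ue.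
by apply: nneseries_lim_ge => k _; rewrite lee_fin normc_ge0.
Unshelve. all: by end_near. Qed.

(** Tannery's theorem, the series form of dominated convergence: the tail bound [e] is uniform in
    [N], so beyond a fixed cut only a finite partial sum has to converge. *)
Lemma csum_cvg (a : nat -> nat -> R[i]) (b : nat -> R[i]) (e : nat -> R) :
  (forall N m, (\sum_(m <= n <oo) (normc (a N n))%:E <= (e m)%:E)%E) ->
  (forall m, (\sum_(m <= n <oo) (normc (b n))%:E <= (e m)%:E)%E) ->
  e m @[m --> \oo] --> (0 : R) ->
  (forall n, a N n @[N --> \oo] --> b n) ->
  csum (a N) @[N --> \oo] --> csum b.
Proof.
move=> ae be e0 ab; apply/cvg_normc/(@cvgrPdist_le _ _ _ \oo) => d d0.
(* Two tails and one difference of partial sums will each cost at most [d / 4]. *)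
have d40 : 0 < d / 4 by rewrite divr_gt0.
have /(@cvgrPdist_le _ _ _ \oo) /(_ _ d40) [m _ /(_ m (leqnn m))] := e0.
rewrite sub0r normrN => em.
have emd : e m <= d / 4 by rewrite (le_trans (ler_norm _)).
have /cvg_normc/(@cvgrPdist_le _ _ _ \oo) /(_ _ d40) :
    series (a N) m @[N --> \oo] --> series b m.
  elim: m {em emd} => [|m ih].
    rewrite /series /= big_geq//; under eq_fun do rewrite big_geq//.
    exact: cvg_cst.
  rewrite seriesSr; under eq_fun do rewrite seriesSr.
  exact: (cvgD ih (ab m)).
apply: filterS => N; rewrite !sub0r !normrN !ger0_norm ?normc_ge0// => abm.
have foo u : (forall m, (\sum_(m <= n <oo) (normc (u n))%:E <= (e m)%:E)%E) ->
    normc (csum u - series u m) <= d / 4.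
  move=> h; apply: le_trans emd; apply: csum_tail => //.
  by apply: (le_lt_trans (h 0%N)); rewrite ltry.
have -> : csum (a N) - csum b = (csum (a N) - series (a N) m)
   + (series (a N) m - series b m) - (csum b - series b m) by ring.
apply: le_trans (le_normcD _ _) _; rewrite normcN.
apply: le_trans (lerD (le_normcD _ _) (foo b be)) _.
have := foo _ (ae N); lra.
Qed.

End ComplexSeries.

(** * Operators on l2 and their matrix entries *)
Section Coordinates.
Context {R : realType}.
Local Notation l2 := (l2 R).
Local Notation bop := (bop R).
Local Notation e := (l2_basis R).
Implicit Types (x y : l2) (S T : bop).

Lemma l2_sumE (I : Type) (r : seq I) (P : pred I) (F : I -> l2) n :
  (\sum_(i <- r | P i) F i) n = \sum_(i <- r | P i) F i n.
Proof. by elim/big_ind2: _ => // x1 x2 y1 y2 <- <-. Qed.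

Lemma bop_sumE (I : Type) (r : seq I) (P : pred I) (F : I -> bop) x :
  (\sum_(i <- r | P i) F i) x = \sum_(i <- r | P i) F i x.
Proof. by elim/big_ind2: _ => // x1 x2 y1 y2 <- <-. Qed.

Lemma l2_basisE k n : e k n = (n == k)%:R. Proof. by []. Qed.

Lemma bop_bound T : exists2 C : R, 0 <= C &
  forall x, l2norm (T x) <= C * l2norm x.
Proof.
have /linear_bounded_continuous/linear_boundedP h := @bop_continuous R T.
have [M [Mr hM]] := h.
have M1 : M < `|M| + 1 by rewrite (le_lt_trans (real_ler_norm Mr))// ltrDl.
exists (complex.Re (`|M| + 1)).
  have : 0 <= `|M| + 1 :> R[i] by rewrite addr_ge0.
  by rewrite lecE => /andP[].
move=> x; have := hM _ M1 x; rewrite !l2_normE => hx.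
have E : `|M| + 1 = (complex.Re (`|M| + 1))%:C :> R[i].
  by rewrite RRe_real// ger0_real// addr_ge0.
by move: hx; rewrite E -rmorphM lecR.
Qed.

Definition l2_head m x : l2 := \sum_(l < m) x l *: e l.

Lemma l2_headE m x n : l2_head m x n = if (n < m)%N then x n else 0.
Proof.
rewrite l2_sumE; under eq_bigr => l _ do rewrite l2Z l2_basisE.
case: ifPn => [nm|].
  rewrite (bigD1 (Ordinal nm))//= eqxx mulr1 big1 ?addr0// => l ln.
  by rewrite (_ : (n == l :> nat) = false) ?mulr0// eq_sym; apply/negbTE.
rewrite -leqNgt => mn; apply: big1 => l _.
by rewrite gtn_eqF ?mulr0// (leq_trans (ltn_ord l)).
Qed.

Lemma l2_tailE m x n : (x - l2_head m x) n = if (n < m)%N then 0 else x n.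
Proof.
rewrite -[LHS]/(x n - l2_head m x n) l2_headE.
by case: ifP; rewrite ?subrr ?subr0.
Qed.

Lemma l2_tail_cvg x : l2norm (x - l2_head m x) @[m --> \oo] --> (0 : R).
Proof.
rewrite -[X in _ --> X](sqrtr0 R).
apply: (@cvg_comp _ _ _ (fun m => fine (sqsum (x - l2_head m x))) Num.sqrt
  _ (nbhs (0 : R))); last exact: sqrt_continuous.
apply: fine_cvg.
have E m : sqsum (x - l2_head m x) = (\sum_(m <= n <oo) (normc (x n) ^+ 2)%:E)%E.
  rewrite ereal_series eseries_mkcond; apply: eq_eseriesr => n _.
  rewrite l2_tailE ltnNge; case: (m <= n)%N => //.
  by rewrite (_ : normc _ = 0) ?expr0n//; exact: normc0.
under eq_fun do rewrite E.
apply: nneseries_tail_cvg; last by move=> n _; rewrite lee_fin sqr_ge0.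
by have := l2_seqP x; rewrite inE.
Qed.

(** Truncating [x] changes [T x] by at most [C] times the norm of the discarded tail. Hence matrix
    entries determine the operator. *)
Lemma bop_coord_cvg T x k :
  \sum_(l < m) x l * T (e l) k @[m --> \oo] --> T x k.
Proof.
have [C C0 TC] := bop_bound T.
apply: (@cvg_normc_le _ _ _ (fun m => C * l2norm (x - l2_head m x))) => [m|].
  have -> : \sum_(l < m) x l * T (e l) k = T (l2_head m x) k.
    by rewrite GRing.linear_sum l2_sumE; apply: eq_bigr => l _; rewrite linearZ.
  rewrite -normcN opprB; apply: le_trans (TC _); rewrite linearB.
  exact: (normc_le_l2norm (T x - T (l2_head m x)) k).
by rewrite -(mulr0 C); apply: cvgM; [exact: cvg_cst|exact: l2_tail_cvg].
Qed.

Lemma bop_ext S T : (forall l k, S (e l) k = T (e l) k) -> S = T.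
Proof.
move=> ST; apply: bopP => x; apply: l2P => k.
have := @bop_coord_cvg S x k; under eq_fun do under eq_bigr do rewrite ST.
move=> /(cvg_lim (@norm_hausdorff _ R[i])) <-.
by rewrite (cvg_lim (@norm_hausdorff _ R[i]) (@bop_coord_cvg T x k)).
Qed.

Definition lower_tri T := forall k l, (k < l)%N -> T (e l) k = 0.

Lemma lower_triE T : lower_tri T ->
  forall x k, T x k = \sum_(l < k.+1) x l * T (e l) k.
Proof.
move=> lT x k.
rewrite -(cvg_lim (@norm_hausdorff _ R[i]) (@bop_coord_cvg T x k)).
apply: (cvg_lim (@norm_hausdorff _ R[i])).
apply: (cvg_near_cst); near=> m.
have km : (k.+1 <= m)%N by near: m; exact: nbhs_infty_ge.
rewrite -!(big_mkord xpredT (fun l => x l * T (e l) k)).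
rewrite (big_cat_nat (leq0n k.+1) km)//= [X in _ + X]big_nat_cond.
rewrite [X in _ + X]big1 ?addr0// => l.
by rewrite andbT => /andP[kl _]; rewrite lT ?mulr0.
Unshelve. all: by end_near. Qed.

End Coordinates.

(** * The w*-topology *)
Lemma cvg_initial (S : choiceType) (T : topologicalType) (f : S -> T)
    (F : set_system S) (s : S) : Filter F ->
  F --> (s : initial_topology f) <-> f x @[x --> F] --> f s.
Proof.
move=> FF; split=> [Fs|h A]; first exact: cvg_comp Fs (@initial_continuous _ _ f s).
rewrite nbhsE => -[_ [[C oC <-] Cs] CA].
by apply: filterS CA _; apply: h; exact: open_nbhs_nbhs.
Qed.

Section WeakStarTopology.
Context {R : realType}.
Local Notation l2 := (l2 R).
Local Notation bop := (bop R).
Local Notation e := (l2_basis R).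
Implicit Types (x y : l2) (S T : bop).

Lemma l2_cauchy_schwarz x y :
  (\sum_(n <oo) (normc (x n) * normc (y n))%:E <= (l2norm x * l2norm y)%:E)%E.
Proof.
have z0 (u v : l2) : l2norm u = 0 ->
    (\sum_(n <oo) (normc (u n) * normc (v n))%:E = 0)%E.
  move=> /l2norm0_eq0 ->; apply: eseries0 => n _ _.
  by rewrite (_ : normc _ = 0) ?mul0r//; exact: normc0.
have [x0|x0] := eqVneq (l2norm x) 0; first by rewrite z0// x0 mul0r.
have [y0|y0] := eqVneq (l2norm y) 0.
  by under eq_eseriesr => n _ do rewrite mulrC; rewrite z0// y0 mulr0.
have {}x0 : 0 < l2norm x by rewrite lt_def x0 l2norm_ge0.
have {}y0 : 0 < l2norm y by rewrite lt_def y0 l2norm_ge0.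
set s := l2norm x in x0 *; set t := l2norm y in y0 *.
have c0 : 0 <= t / s / 2 by rewrite !divr_ge0 ?ltW.
have d0 : 0 <= s / t / 2 by rewrite !divr_ge0 ?ltW.
(* Young's inequality for each term, weighted by the two norms so that the bounds sum exactly to
   [s * t]. *)
apply: (@le_trans _ _ ((t / s / 2)%:E * sqsum x + (s / t / 2)%:E * sqsum y)%E).
  rewrite /sqsum -!nneseriesZl; try by move=> n _; rewrite lee_fin sqr_ge0.
  rewrite -nneseriesD; last 2 first.
    by move=> n _ _; rewrite -EFinM lee_fin mulr_ge0 ?sqr_ge0.
    by move=> n _ _; rewrite -EFinM lee_fin mulr_ge0 ?sqr_ge0.
  apply: lee_nneseries => n _; first by move=> _; rewrite lee_fin mulr_ge0 ?normc_ge0.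
  rewrite -!EFinM -EFinD lee_fin; set a := normc _; set b := normc _.
  rewrite -subr_ge0.
  have -> : t / s / 2 * a ^+ 2 + s / t / 2 * b ^+ 2 - a * b =
      (2 * s * t)^-1 * (t * a - s * b) ^+ 2.
    by field; rewrite !gt_eqF.
  by rewrite mulr_ge0 ?sqr_ge0// invr_ge0 !mulr_ge0 ?ltW.
rewrite !sqr_l2norm -!EFinM -EFinD lee_fin -/s -/t le_eqVlt; apply/orP; left.
by apply/eqP; field; rewrite !gt_eqF.
Qed.

Lemma normc_conj (z : R[i]) : normc z^* = normc z.
Proof. by have := norm_conjC z; rewrite !normcR => -[]. Qed.

(** Cauchy-Schwarz against [y] with its head removed. The bound sees [x] only through its norm,
    which yields the uniform tails required by [csum_cvg]. *)
Lemma inner_tail x y m :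
  (\sum_(m <= n <oo) (normc (x n * (y n)^*))%:E <=
     (l2norm x * l2norm (y - l2_head m y))%:E)%E.
Proof.
apply: le_trans (l2_cauchy_schwarz _ _).
rewrite ereal_series eseries_mkcond; apply: lee_nneseries => n _.
  by case: ifP => // _; rewrite lee_fin normc_ge0.
rewrite l2_tailE ltnNge; case: (m <= n)%N; rewrite lee_fin.
  by rewrite normcM normc_conj.
by rewrite mulr_ge0 ?normc_ge0.
Qed.

Lemma inner_summable x y :
  (\sum_(n <oo) (normc (x n * (y n)^*))%:E < +oo)%E.
Proof. by apply: le_lt_trans (inner_tail x y 0) _; rewrite ltry. Qed.

Lemma normc_inner x y : normc (inner x y) <= l2norm x * l2norm y.
Proof.
have /csum_tail := inner_tail x y 0.
rewrite /l2_head big_ord0 /series /= big_geq// !subr0; apply.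
exact: inner_summable.
Qed.

Lemma innerBl x y z : inner (x - y) z = inner x z - inner y z.
Proof.
rewrite -(csumB (inner_summable x z) (inner_summable y z)).
by congr (limn (series _)); apply/funext => n; rewrite -mulrBl.
Qed.

Lemma inner0l y : inner 0 y = 0.
Proof. by rewrite -[X in inner X _](subrr 0) innerBl subrr. Qed.

Lemma inner_basis x k : inner x (e k) = x k.
Proof.
apply: (cvg_lim (@norm_hausdorff _ R[i])).
apply: cvg_near_cst; near=> m.
have km : (k < m)%N by near: m; exact: nbhs_infty_gt.
rewrite /series /= big_mkord (bigD1 (Ordinal km))//= eqxx conjC1 mulr1.
rewrite big1 ?addr0// => n nk.
by rewrite (_ : (n == k :> nat) = false) ?conjC0 ?mulr0//; apply/negbTE.
Unshelve. all: by end_near. Qed.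

Lemma inner_cvg (x_ : nat -> l2) x y (C : R) :
  (forall N, l2norm (x_ N) <= C) -> l2norm x <= C ->
  (forall k, x_ N k @[N --> \oo] --> x k) ->
  inner (x_ N) y @[N --> \oo] --> inner x y.
Proof.
move=> xC xC' xx.
have h z : l2norm z <= C -> forall m,
    (\sum_(m <= n <oo) (normc (z n * (y n)^*))%:E <=
    (C * l2norm (y - l2_head m y))%:E)%E.
  move=> zC m; apply: (le_trans (inner_tail _ _ _)).
  by rewrite lee_fin ler_wpM2r// l2norm_ge0.
apply: (csum_cvg _ (h x xC')) => [N||n].
- exact: h.
- by rewrite -(mulr0 C); apply: cvgM; [exact: cvg_cst|exact: l2_tail_cvg].
- by apply: cvgM; [exact: xx|exact: cvg_cst].
Qed.

(** Two layers are unfolded: the w*-topology is initial for a map into a pointwise product, and that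
    product carries the supremum of the topologies initial for the evaluations. *)
Lemma wstar_cvgP (F : set_system bop) (FF : Filter F) T :
  F --> T <->
  forall w, normal_functional w S @[S --> F] --> normal_functional w T.
Proof.
apply: iff_trans (cvg_initial (@normal_functionals R) T FF) _.
have fF := fmap_filter (@normal_functionals R) FF.
apply: iff_trans (@cvg_sup _ _ _ _ (normal_functionals T) fF) _.
pose ev w (f : square_summable_family R * square_summable_family R -> R[i]) := f w.
have P w := @cvg_initial _ _ (ev w) _ (normal_functionals T) fF.
by split=> h w; have := h w; [case: (P w) => + _; exact | case: (P w) => _; exact].
Qed.

Lemma normal_functional_continuous w : continuous (@normal_functional R w).
Proof. by move=> T; have /wstar_cvgP := @cvg_id _ (nbhs T); exact. Qed.

(** Families supported at index 0 reduce the series of a normal functional to one inner product,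
    which exhibits each matrix entry as w*-continuous. *)
Definition basis_family k : nat -> l2 := fun n => if n is 0 then e k else 0.

Lemma basis_family_summable k :
  (\sum_(n <oo) (l2norm (basis_family k n) ^+ 2)%:E < +oo)%E.
Proof.
rewrite (@nneseriesD1 _ _ 0)//=; last by move=> n _; rewrite lee_fin sqr_ge0.
rewrite eseries0 ?adde0 ?ltry// => -[|n]// _ _ /=.
by rewrite -(scale0r 0) l2normZ (_ : normc _ = 0) ?mul0r ?expr0n//; exact: normc0.
Qed.

Lemma coord_continuous k l : continuous (fun T : bop => T (e l) k).
Proof.
pose w : square_summable_family R * square_summable_family R :=
  (exist _ (basis_family l) (basis_family_summable l),
   exist _ (basis_family k) (basis_family_summable k)).
rewrite (_ : (fun T : bop => _) = normal_functional w).
  exact: normal_functional_continuous.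
apply/funext => T; rewrite -[LHS]inner_basis; apply/esym.
apply: (cvg_lim (@norm_hausdorff _ R[i])).
apply: cvg_near_cst; near=> m.
have m0 : (0 < m)%N by near: m; exact: nbhs_infty_gt.
rewrite /series /= big_ltn//= big_nat_cond big1 ?addr0// => -[|n]//= _.
by rewrite linear0 inner0l.
Unshelve. all: by end_near. Qed.

(** On norm-bounded sequences coordinatewise convergence suffices: [inner_cvg] handles each term of
    a normal functional, and the terms have a summable bound independent of the operator. *)
Lemma wstar_cvg (T_ : nat -> bop) T (C : R) : 0 <= C ->
  (forall N x, l2norm (T_ N x) <= C * l2norm x) ->
  (forall x, l2norm (T x) <= C * l2norm x) ->
  (forall x k, T_ N x k @[N --> \oo] --> T x k) ->
  T_ N @[N --> \oo] --> T.
Proof.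
move=> C0 TC TC' TT; apply/wstar_cvgP => -[[x xs] [y ys]].
(* Dominates the k-th term, since a product of two nonnegative reals is at most the sum of their
   squares. *)
pose g k : \bar R := (C * l2norm (x k) ^+ 2 + C * l2norm (y k) ^+ 2)%:E.
have g0 k : (0 <= g k)%E.
  by rewrite lee_fin addr_ge0// mulr_ge0// sqr_ge0.
have goo : (\sum_(k <oo) g k < +oo)%E.
  rewrite /g; under eq_eseriesr => k _ do rewrite EFinD !EFinM.
  rewrite nneseriesD; last 2 first.
    by move=> n _ _; rewrite -EFinM lee_fin mulr_ge0 ?sqr_ge0.
    by move=> n _ _; rewrite -EFinM lee_fin mulr_ge0 ?sqr_ge0.
  rewrite !nneseriesZl; try by move=> n _; rewrite lee_fin sqr_ge0.
  by apply: lte_add_pinfty; apply: lte_mul_pinfty.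
have gt m : (\sum_(m <= k <oo) g k)%E \is a fin_num.
  rewrite ge0_fin_numE; last by apply: nneseries_ge0.
  apply: le_lt_trans goo; rewrite [leRHS](nneseries_split 0 m)// add0n.
  by rewrite leeDr// sume_ge0.
have h S : (forall x, l2norm (S x) <= C * l2norm x) -> forall m,
    (\sum_(m <= k <oo) (normc (inner (S (x k)) (y k)))%:E <=
      (fine (\sum_(m <= k <oo) g k))%:E)%E.
  move=> SC m; rewrite fineK//; apply: lee_nneseries => k; rewrite lee_fin.
    by rewrite normc_ge0.
  move=> _; apply: (le_trans (normc_inner _ _)).
  apply: (@le_trans _ _ (C * (l2norm (x k) * l2norm (y k)))).
    by rewrite mulrA ler_wpM2r ?l2norm_ge0.
  rewrite -mulrDr ler_wpM2l//.
  have := l2norm_ge0 (x k); have := l2norm_ge0 (y k); nra.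
apply: (csum_cvg _ (h T TC')) => [N||k] /=.
- exact: h.
- by apply: fine_cvg; apply: nneseries_tail_cvg.
- exact: (@inner_cvg _ _ _ (C * l2norm (x k))).
Qed.

End WeakStarTopology.

(** * Fejer means *)
(** The defect, multiplied by the number of terms, is the sum of the squares of the deviations
    [n a_i - A], where [A] is the total. *)
Lemma sqr_sum_le (R : realFieldType) m n (a : nat -> R) :
  (\sum_(m <= i < m + n) a i) ^+ 2 <= n%:R * \sum_(m <= i < m + n) a i ^+ 2.
Proof.
set A := \sum_(m <= i < m + n) a i; set B := \sum_(m <= i < m + n) a i ^+ 2.
case: n => [|n] in A B *.
  by rewrite /A addn0 big_geq// expr0n mul0r.
rewrite -subr_ge0 -(@pmulr_rge0 _ n.+1%:R)// -/A.
have -> : n.+1%:R * (n.+1%:R * B - A ^+ 2) =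
    \sum_(m <= i < m + n.+1) (n.+1%:R * a i - A) ^+ 2.
  transitivity (\sum_(m <= i < m + n.+1)
      (n.+1%:R ^+ 2 * a i ^+ 2 - (n.+1%:R * A *+ 2) * a i + A ^+ 2)).
    rewrite big_split sumrB -!mulr_sumr -/A -/B /=.
    rewrite sumr_const_nat addKn -mulr_natl mulr2n; ring.
  by apply: eq_bigr => i _; rewrite mulr2n; ring.
by apply: sumr_ge0 => i _; exact: sqr_ge0.
Qed.

Lemma nneseries_window (R : realType) (f : nat -> \bar R) k N :
  (forall n, (0 <= f n)%E) ->
  (\sum_(s <oo) (if (k <= s < k + N)%N then f s else 0) = \sum_(k <= s < k + N) f s)%E.
Proof.
move=> f0; rewrite (nneseries_split 0 (k + N)); last by move=> s _; case: ifP.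
rewrite add0n [X in (_ + X)%E]eseries0 ?adde0; last first.
  by move=> s /leq_gtF; rewrite andbC => ->.
rewrite (big_cat_nat (leq0n k) (leq_addr N k))/= big_nat big1 ?add0e; last first.
  by move=> s /= sk; rewrite leqNgt sk.
by rewrite big_nat [RHS]big_nat; apply: eq_bigr => s ->.
Qed.

Section Fejer.
Context {R : realType}.
Local Notation l2 := (l2 R).
Local Notation bop := (bop R).
Local Notation e := (l2_basis R).
Implicit Types (x y : l2) (S T : bop).

Lemma coord_projE (A : set nat) (b : bool) x n : reflect (A n) b ->
  coord_proj R A x n = if b then x n else 0.
Proof.
move=> Ab; rewrite -[LHS]/(\1_A n * x n) indicE.
have -> : (n \in A) = b by apply/idP/Ab; rewrite inE.
by case: b {Ab}; rewrite ?mul1r ?mul0r.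
Qed.

(* At row k only the windows [s - N + 1, s] with [k <= s < k + N] contribute. *)
Lemma fejer_window T S N : (0 < N)%N -> lower_tri T ->
  (forall k l, S (e l) k = (N - (k - l))%:R / N%:R * T (e l) k) ->
  forall x k, N%:R * S x k = \sum_(k <= s < k + N)
    T (coord_proj R [set n | (n <= s < n + N)%N] x) k.
Proof.
move=> N0 lT ST x k.
have lS : lower_tri S by move=> i j ij; rewrite ST lT ?mulr0.
rewrite lower_triE//; under [RHS]eq_bigr => s _ do rewrite lower_triE//.
rewrite exchange_big mulr_sumr; apply: eq_bigr => l _.
rewrite -mulr_suml ST.
have lk : (l <= k)%N by rewrite -ltnS.
(* Since [l <= k], column [l] survives exactly for [k <= s < l + N], which leaves [N - (k - l)]
   values of [s], none when the truncated difference is 0. *)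
have -> : \sum_(k <= s < k + N) coord_proj R [set n | (n <= s < n + N)%N] x l =
    x l *+ (N - (k - l)).
  transitivity (\sum_(k <= s < k + N | (s < l + N)%N) x l).
    rewrite [RHS]big_mkcond [LHS]big_nat [RHS]big_nat.
    apply: eq_bigr => s /andP[ks _].
    by rewrite (coord_projE _ idP) (leq_trans lk ks).
  rewrite -(big_nat_widen _ _ _ xpredT) ?leq_add2r// sumr_const_nat.
  by congr (_ *+ _); lia.
rewrite -mulr_natl; field.
by rewrite pnatr_eq0 -lt0n.
Qed.

(** Cauchy-Schwarz over the [N] windows meeting row [k] bounds the squared entry of [S x] by [1/N]
    times the sum of the squared entries of [T (E s x)]. Summing over rows and using the bound on
    [T] leaves [C ^+ 2 / N] times the total squared norm of the windowed vectors, and that total is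
    [N] times the squared norm of [x]. *)
Lemma fejer_bound T S N (C : R) : (0 < N)%N -> lower_tri T ->
  (forall k l, S (e l) k = (N - (k - l))%:R / N%:R * T (e l) k) ->
  0 <= C -> (forall x, l2norm (T x) <= C * l2norm x) ->
  forall x, l2norm (S x) <= C * l2norm x.
Proof.
move=> N0 lT ST C0 TC x; apply: l2norm_le => //.
pose E s := coord_proj R [set n | (n <= s < n + N)%N].
have Nr0 : 0 < N%:R :> R by rewrite ltr0n.
have Ni0 : 0 <= N%:R^-1 :> R by rewrite invr_ge0 ltW.
have q0 (y : nat -> R[i]) n : (0 <= (normc (y n) ^+ 2)%:E)%E.
  by rewrite lee_fin sqr_ge0.
have step1 : (sqsum (S x) <= \sum_(k <oo) \sum_(s <oo)
    if (k <= s < k + N)%N then (N%:R^-1 * normc (T (E s x) k) ^+ 2)%:E else 0)%E.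
  apply: lee_nneseries => k _; first by move=> _; exact: q0.
  rewrite nneseries_window; last by move=> n; rewrite lee_fin mulr_ge0 ?sqr_ge0.
  rewrite sumEFin lee_fin -mulr_sumr ler_pdivlMl//.
  rewrite -(@ler_pM2l _ N%:R)// mulrA -expr2.
  have -> : N%:R ^+ 2 * normc (S x k) ^+ 2 =
      normc (\sum_(k <= s < k + N) T (E s x) k) ^+ 2.
    rewrite -(fejer_window N0 lT ST) normcM exprMn; congr (_ ^+ 2 * _).
    by rewrite -(rmorph_nat (real_complex R)) normc_real ger0_norm.
  apply: le_trans (sqr_sum_le _ _ _).
  by rewrite lerXn2r ?nnegrE ?normc_ge0 ?sumr_ge0 ?normc_sum// => *; rewrite normc_ge0.
apply: (le_trans step1); rewrite nneseries_interchange; last first.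
  by move=> k s; case: ifP => // _; rewrite lee_fin mulr_ge0 ?sqr_ge0.
apply: (@le_trans _ _ (\sum_(s <oo) (N%:R^-1 * C ^+ 2)%:E * sqsum (E s x))%E).
  apply: lee_nneseries => s _.
    move=> _; apply: nneseries_ge0 => k _ _; case: ifP => // _.
    by rewrite lee_fin mulr_ge0 ?sqr_ge0.
  (* Forgetting the restriction on rows only adds nonnegative terms. *)
  apply: (@le_trans _ _ (N%:R^-1%:E * sqsum (T (E s x)))%E).
    rewrite /sqsum -nneseriesZl; last by move=> n _; exact: q0.
    apply: lee_nneseries => k _.
      by move=> _; case: ifP => // _; rewrite lee_fin mulr_ge0 ?sqr_ge0.
    by case: ifP => // _; rewrite -EFinM lee_fin mulr_ge0 ?sqr_ge0.
  rewrite EFinM -muleA lee_pmul2l// ?lte_fin ?invr_gt0//.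
  rewrite !sqr_l2norm -EFinM lee_fin -exprMn.
  by rewrite lerXn2r ?nnegrE ?mulr_ge0 ?l2norm_ge0.
rewrite nneseriesZl; last by move=> s _; exact: sqsum_ge0.
(* Each coordinate [n] lies in exactly [N] windows, those with [n <= s < n + N]; this cancels the
   factor [1/N]. *)
rewrite (_ : (\sum_(s <oo) sqsum (E s x) = N%:R%:E * sqsum x)%E).
  by rewrite muleA -EFinM mulrAC mulVf ?mul1r// gt_eqF.
rewrite /sqsum nneseries_interchange; last by move=> s n; exact: q0.
rewrite -nneseriesZl; last by move=> n _; exact: q0.
apply: eq_eseriesr => n _.
transitivity (\sum_(s <oo)
    if (n <= s < n + N)%N then (normc (x n) ^+ 2)%:E else 0%E)%E.
  apply: eq_eseriesr => s _; rewrite (coord_projE _ idP).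
  case: ifP => //; rewrite (_ : normc _ = 0) ?expr0n//; exact: normc0.
rewrite nneseries_window//.
by rewrite sumEFin sumr_const_nat addKn -EFinM mulr_natl.
Qed.

Lemma fejer_coef_cvg d :
  (N.+1 - d)%:R / N.+1%:R @[N --> \oo] --> (1 : R[i]).
Proof.
apply: (@cvg_normc_le _ _ _ (fun N => d%:R * harmonic N)) => [N|].
  have N0 : N.+1%:R != 0 :> R[i] by rewrite pnatr_eq0.
  have -> : (N.+1 - d)%:R / N.+1%:R - 1 = - ((minn d N.+1)%:R / N.+1%:R) :> R[i].
    (* Natural subtraction truncates when [d] exceeds [N.+1]; with [minn] it becomes exact and
       passes to the field. *)
    have -> : (N.+1 - d = N.+1 - minn d N.+1)%N by lia.
    by rewrite natrB ?geq_minr//; field.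
  rewrite normcN -(rmorph_nat (real_complex R)).
  rewrite -[X in _ / X](rmorph_nat (real_complex R)).
  rewrite -fmorph_div normc_real ger0_norm ?divr_ge0//.
  by rewrite ler_wpM2r ?invr_ge0// ler_nat geq_minl.
by rewrite -(mulr0 d%:R); apply: cvgM; [exact: cvg_cst|exact: cvg_harmonic].
Qed.

(** The means inherit the norm bound of [T], and each of their rows is a finite sum whose weights
    tend to 1, so [wstar_cvg] applies. Indexing by [N.+1] avoids division by zero. *)
Lemma fejer_cvg T (S_ : nat -> bop) : lower_tri T ->
  (forall N k l,
    S_ N (e l) k = (N.+1 - (k - l))%:R / N.+1%:R * T (e l) k) ->
  S_ N @[N --> \oo] --> T.
Proof.
move=> lT ST; have [C C0 TC] := bop_bound T.
apply: (wstar_cvg C0) => // [N|x k]; first exact: (fejer_bound _ lT (ST N)).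
have lS N : lower_tri (S_ N) by move=> i j ij; rewrite ST lT ?mulr0.
rewrite lower_triE//; under eq_fun => N do rewrite lower_triE//.
apply: cvg_big => [|l _]; first exact: (@add_continuous R[i]).
apply: cvgM; first exact: cvg_cst.
under eq_fun do rewrite ST.
have := cvgM (fejer_coef_cvg (k - l)) (cvg_cst (T (e l) k)).
by rewrite mul1r; exact.
Qed.

End Fejer.

(** * The commutant of the shift *)
Section ShiftCommutant.
Context {R : realType}.
Local Notation l2 := (l2 R).
Local Notation bop := (bop R).
Local Notation e := (l2_basis R).
Local Notation v := (shift_op R).
Implicit Types (x y : l2) (S T : bop).

Lemma bop_mulE S T x : (S * T) x = S (T x). Proof. by []. Qed.

Lemma shiftXE n x k : (v ^+ n) x k = if (n <= k)%N then x (k - n)%N else 0.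
Proof.
elim: n k => [|n ih] k; first by rewrite expr0 subn0.
by rewrite exprS bop_mulE; case: k => [|k]//=; rewrite ih.
Qed.

Lemma shift_basis l : v (e l) = e l.+1.
Proof. by apply: l2P => -[|k]. Qed.

Lemma shiftX_basis n : (v ^+ n) (e 0) = e n.
Proof.
by elim: n => [|n ih]; [rewrite expr0|rewrite exprS bop_mulE ih shift_basis].
Qed.

(** Column [l] is the image of column 0 under [v ^+ l], so the matrix is constant along diagonals
    and vanishes above the main one. *)
Lemma commute_shift_coord T : T * v = v * T ->
  forall k l, T (e l) k = if (l <= k)%N then T (e 0) (k - l)%N else 0.
Proof.
move=> Tv k l; have TvX : T * v ^+ l = v ^+ l * T by exact: commrX.
by rewrite -shiftX_basis -[T _]/((T * v ^+ l) (e 0)) TvX bop_mulE shiftXE.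
Qed.

Lemma closed_coord_eq k l k' l' :
  closed [set T : bop | T (e l) k = T (e l') k'].
Proof.
rewrite (_ : mkset _ = (fun T : bop => T (e l) k - T (e l') k') @^-1` [set 0]).
  apply: closed_comp => [T _|].
    exact: (cvgB (@coord_continuous R k l T) (@coord_continuous R k' l' T)).
  exact/accessible_closed_set1/hausdorff_accessible/norm_hausdorff.
by apply/seteqP; split=> T /= h; [rewrite h subrr|exact: subr0_eq].
Qed.

Lemma closed_coord_eq0 k l : closed [set T : bop | T (e l) k = 0].
Proof.
rewrite (_ : mkset _ = (fun T : bop => T (e l) k) @^-1` [set 0])//.
apply: closed_comp => [T _|]; first exact: (@coord_continuous R k l T).
exact/accessible_closed_set1/hausdorff_accessible/norm_hausdorff.
Qed.

(** Written through single matrix entries, which are w*-continuous, commutation with [v] becomes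
    visibly a w*-closed condition. *)
Lemma shift_commutantP T : T * v = v * T <->
  (forall l, T (e l.+1) 0%N = 0) /\
  (forall k l, T (e l.+1) k.+1 = T (e l) k).
Proof.
split=> [Tv|[T0 TS]].
  have E k l : T (e l.+1) k = v (T (e l)) k by rewrite -shift_basis -!bop_mulE Tv.
  by split=> [l|k l]; rewrite E.
apply: bop_ext => l k; rewrite !bop_mulE shift_basis.
by case: k => [|k]; rewrite ?T0 ?TS.
Qed.

Lemma closed_shift_commutant : closed [set T : bop | T * v = v * T].
Proof.
rewrite (_ : mkset _ =
  (\bigcap_l [set T : bop | T (e l.+1) 0%N = 0]) `&`
  \bigcap_k \bigcap_l [set T : bop | T (e l.+1) k.+1 = T (e l) k]).
  apply: closedI.
    by apply: closed_bigI => l _; exact: closed_coord_eq0.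
  by apply: closed_bigI => k _; apply: closed_bigI => l _; exact: closed_coord_eq.
apply/seteqP; split=> T.
  by move=> /shift_commutantP[h1 h2]; split=> [l _|k _ l _]; [exact: h1|exact: h2].
by move=> [h1 h2]; apply/shift_commutantP; split=> [l|k l]; [exact: h1|exact: h2].
Qed.

(** The commutant of [v] is a w*-closed algebra containing both generators. Conversely, the Fejer
    means of an operator in it are polynomials in [v], hence lie in every competing algebra [A], and
    so does their limit. *)
Lemma analytic_toeplitzP T : analytic_toeplitz R T <-> T * v = v * T.
Proof.
split=> [TT|Tv].
  apply: (TT [set T | T * v = v * T]); split; last first.
    by move=> _ [->|->] //=; rewrite mul1r mulr1.
  split; last exact: closed_shift_commutant.
  split; [split=> [|a S U]|move=> S U]; rewrite !inE /=.
  - by rewrite mul0r mulr0.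
  - move=> Sv Uv; apply: bopP => x.
    rewrite -[LHS]/(a *: (S * v) x + (U * v) x) Sv Uv !bop_mulE.
    exact: (esym (linearP (shift_op R) a (S x) (U x))).
  - by move=> Sv Uv; rewrite -mulrA Uv mulrA Sv mulrA.
move=> A [[[[A0 Alin] Amul] Acl] GA].
have Av : A v by apply: GA; left.
have A1 : A 1 by apply: GA; right.
have AX n : A (v ^+ n).
  elim: n => [|n ih]; first by rewrite expr0.
  by have := Amul v (v ^+ n); rewrite !inE exprS; exact.
(* Column 0 lists the Taylor coefficients of the symbol; each is damped by its Fejer weight. *)
pose c N d : R[i] := (N.+1 - d)%:R / N.+1%:R * T (e 0) d.
pose S_ N : bop := \sum_(d < N.+1) c N d *: v ^+ d.
have AS N : A (S_ N).
  rewrite /S_; elim/big_ind: _ => [|U V AU AV|d _].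
  - by have := A0; rewrite inE.
  - by have := Alin 1 U V; rewrite !inE scale1r; exact.
  - have := Alin (c N d) (v ^+ d) 0; rewrite !inE addr0; apply => //.
    by have := A0; rewrite inE.
have ST : S_ N @[N --> \oo] --> T.
  apply: fejer_cvg => [k l kl|N k l].
    by rewrite commute_shift_coord// leqNgt kl.
  rewrite /S_ bop_sumE l2_sumE (commute_shift_coord Tv).
  transitivity (\sum_(d < N.+1) if (k == l + d)%N then c N d else 0).
    apply: eq_bigr => d _.
    rewrite -[LHS]/(c N d * (v ^+ d) (e l) k) -shiftX_basis -bop_mulE -exprD.
    rewrite shiftX_basis l2_basisE addnC.
    by case: eqP; rewrite ?mulr1 ?mulr0.
  case: (leqP l k) => lk; last first.
    by rewrite mulr0 big1// => d _; case: eqP => // kld; move: lk; rewrite kld; lia.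
  have [kN|kN] := ltnP (k - l) N.+1.
    rewrite (bigD1 (Ordinal kN))//= subnKC// eqxx big1 ?addr0// => d dk.
    case: eqP => // kld; case/eqP: dk; apply: val_inj => /=; lia.
  (* The truncated weight vanishes exactly where the polynomial has no term. *)
  rewrite (_ : N.+1 - (k - l) = 0)%N; last by lia.
  by rewrite mul0r mul0r big1// => d _; case: eqP => // kld; have := ltn_ord d; lia.
exact: (closed_cvg A Acl (nearW _ AS) T ST).
Qed.

Lemma lower_triangularP T : lower_triangular R T <-> lower_tri T.
Proof. by split=> h k l kl; have := h k l kl; rewrite inner_basis. Qed.

Lemma lshift_subproof (x : l2) : (fun n => x n.+1) \in @square_summable R.
Proof.
have := l2_seqP x; rewrite !inE /=; apply: le_lt_trans.
rewrite /sqsum [leRHS]nneseries_recl//; last by move=> n _; rewrite lee_fin sqr_ge0.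
rewrite -(@nneseries_addn _ _ 1); last by move=> n; rewrite lee_fin sqr_ge0.
under [X in (_ <= _ + X)%E]eq_eseriesr do rewrite addn1.
by rewrite leeDr// lee_fin sqr_ge0.
Qed.

Lemma lshift_op_subproof :
  (fun x => L2 (lshift_subproof x)) \in @bounded_operator R.
Proof.
apply: (@bounded_operator_of _ 1) => [a x y|x]; first exact: l2P.
apply: l2norm_le => //; rewrite expr1n mul1e.
rewrite /sqsum [leRHS]nneseries_recl//; last by move=> n _; rewrite lee_fin sqr_ge0.
rewrite -(@nneseries_addn _ _ 1); last by move=> n; rewrite lee_fin sqr_ge0.
under [X in (_ <= _ + X)%E]eq_eseriesr do rewrite addn1.
by rewrite leeDr// lee_fin sqr_ge0.
Qed.

(** The backward shift, the adjoint of [shift_op]. *)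
Definition lshift_op : bop := Bop lshift_op_subproof.

Lemma lshiftXE n x k : (lshift_op ^+ n) x k = x (k + n)%N.
Proof.
elim: n k => [|n ih] k; first by rewrite expr0 addn0.
by rewrite exprS bop_mulE -[LHS]/((lshift_op ^+ n) x k.+1) ih addSnnS.
Qed.

End ShiftCommutant.

(** * Toeplitz operators on the residue classes *)
Section LinearSumStructure.
Context {R : realType}.
Variables (n0 p : nat).
Hypothesis p0 : (0 < p)%N.
Local Notation l2 := (l2 R).
Local Notation bop := (bop R).
Local Notation e := (l2_basis R).
Local Notation v := (shift_op R).
Local Notation w := (lshift_op (R := R)).
Implicit Types (x y : l2) (S T A : bop) (B : 'I_p -> bop).

Lemma coord_proj_basis (D : set nat) (b : bool) n : reflect (D n) b ->
  coord_proj R D (e n) = if b then e n else 0.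
Proof.
move=> Db; apply: l2P => k; rewrite (coord_projE _ (asboolP _)) l2_basisE.
have [->|kn] := eqVneq k n.
  by rewrite (asbool_equiv_eq (rwP Db)) asboolb; case: b {Db}; rewrite //= eqxx.
by case: ifP => _; case: b {Db}; rewrite //= (negbTE kn).
Qed.

Lemma proj_per_basis n (i : 'I_p) : proj_per R n0 p i (e n) =
  if (n0 <= n)%N && ((n - n0) %% p == i)%N then e n else 0.
Proof.
apply: coord_proj_basis; apply: (iffP andP) => [[n0n /eqP E]|[j _ <-]].
  exists ((n - n0) %/ p)%N => //.
  by have := divn_eq (n - n0) p; rewrite E mulnC; lia.
split; first by rewrite -addnA leq_addr.
by rewrite -addnA addKn mulnC addnC modnMDl modn_small.
Qed.

Lemma proj_pre_basis n : proj_pre R n0 (e n) = if (n < n0)%N then e n else 0.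
Proof. exact: coord_proj_basis idP. Qed.

Lemma sum_op_basis A B l : sum_op n0 A B (e l) =
  A (proj_pre R n0 (e l)) + \sum_(i < p) B i (proj_per R n0 p i (e l)).
Proof.
rewrite -(bop_sumE _ _ (fun i => B i * proj_per R n0 p i)).
exact: erefl.
Qed.

Lemma sum_op_pre A B l : (l < n0)%N -> sum_op n0 A B (e l) = A (e l).
Proof.
move=> ln0; rewrite sum_op_basis proj_pre_basis ln0 big1 ?addr0// => i _.
by rewrite proj_per_basis leqNgt ln0 linear0.
Qed.

Lemma sum_op_per A B (i : 'I_p) j :
  sum_op n0 A B (e (n0 + i + p * j)%N) = B i (e (n0 + i + p * j)%N).
Proof.
have E : ((n0 + i + p * j - n0) %% p = i)%N.
  by rewrite -addnA addKn mulnC addnC modnMDl modn_small.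
have le : (n0 <= n0 + i + p * j)%N by rewrite -addnA leq_addr.
rewrite sum_op_basis proj_pre_basis ltnNge le linear0 add0r (bigD1 i)//.
rewrite big1 => [|i' ii']; first by rewrite proj_per_basis le E eqxx /= addr0.
rewrite proj_per_basis le E (_ : (i == i' :> nat) = false) ?linear0//.
by rewrite eq_sym; apply/negbTE.
Qed.

Lemma index_split l : (l < n0)%N \/ exists (i : 'I_p) j, l = (n0 + i + p * j)%N.
Proof.
have [|n0l] := ltnP l n0; [by left|right].
exists (Ordinal (ltn_pmod (l - n0) p0)), ((l - n0) %/ p)%N => /=.
by have := divn_eq (l - n0) p; rewrite mulnC; lia.
Qed.

Definition eventually_periodic T :=
  forall k l, (n0 <= l)%N -> T (e (l + p)%N) (k + p)%N = T (e l) k.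

Lemma eventually_periodicX T : eventually_periodic T -> forall j k l, (n0 <= l)%N ->
  T (e (l + p * j)%N) (k + p * j)%N = T (e l) k.
Proof.
move=> Tp; elim=> [|j ih] k l n0l; first by rewrite muln0 !addn0.
by rewrite mulnSr !addnA Tp ?ih// (leq_trans n0l)// leq_addr.
Qed.

(* The Toeplitz operator whose symbol is the column [T (e a)] shifted to start
   at the diagonal; it is bounded because every residue class mod p can be
   moved onto the class of a, where T is already bounded. *)
Definition toeplitz_of T a : bop :=
  \sum_(r < p) v ^+ r * w ^+ a * T * v ^+ a * w ^+ r *
    coord_proj R [set n | n %% p == r]%N.

(** For [l = r + p * j] only the summand of residue [r] acts. It sends [e l] to [e (a + p * j)]
    before [T], periodicity of [T] removes [p * j], and the outer shifts restore the row index. *)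
Lemma toeplitz_ofE T a : lower_tri T -> eventually_periodic T -> (n0 <= a)%N ->
  forall k l, toeplitz_of T a (e l) k =
    if (l <= k)%N then T (e a) (k - l + a)%N else 0.
Proof.
move=> lT Tp n0a k l; rewrite /toeplitz_of bop_sumE l2_sumE.
have lp := ltn_pmod l p0.
rewrite (bigD1 (Ordinal lp))// big1; last first.
  move=> r rl; rewrite bop_mulE (coord_proj_basis (b := false)) ?linear0//.
  apply: (iffP idP) => //= /eqP E; case/eqP: rl.
  exact: val_inj.
rewrite [LHS]addr0 bop_mulE (coord_proj_basis (b := true)); last first.
  by apply: (iffP idP) => //=; rewrite eqxx.
rewrite !bop_mulE.
set r := (l %% p)%N; set j := (l %/ p)%N.
have lE : (l = r + p * j)%N by rewrite {1}(divn_eq l p) mulnC addnC.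
have -> : (v ^+ a) ((w ^+ r) (e l)) = e (a + p * j)%N.
  apply: l2P => i; rewrite shiftXE lshiftXE !l2_basisE lE.
  case: leqP => ai; last by rewrite (_ : (i == _) = false)//; lia.
  by congr (_%:R); congr (nat_of_bool _); lia.
rewrite shiftXE lshiftXE /= -/r.
have [lk|kl] := leqP l k.
  rewrite ifT; last by rewrite (leq_trans _ lk)// leq_mod.
  rewrite -(eventually_periodicX Tp j _ n0a); congr (l2_seq _ _); lia.
by case: leqP => // rk; rewrite lT//; lia.
Qed.

(** Each column of the sum is a column of [A] or of a single [B i], and a step by [p] stays in the
    same residue class, where the Toeplitz form of [B i] gives periodicity. *)
Lemma linear_sumP T :
  linear_sum n0 p (lower_triangular R) (analytic_toeplitz R) T <->
  lower_tri T /\ eventually_periodic T.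
Proof.
split=> [[A [B [/lower_triangularP lA tB ->]]]|[lT Tp]].
  have {}tB i := (analytic_toeplitzP (B i)).1 (tB i).
  split=> k l.
    move=> kl; have [ln0|[i [j lE]]] := index_split l; first by rewrite sum_op_pre// lA.
    by rewrite lE sum_op_per (commute_shift_coord (tB i)) -lE leqNgt kl.
  move=> n0l; have [|[i [j ->]]] := index_split l; first by rewrite ltnNge n0l.
  have jS : (n0 + i + p * j + p = n0 + i + p * j.+1)%N by rewrite mulnSr addnA.
  rewrite jS !sum_op_per -jS (commute_shift_coord (tB i) (k + p)).
  rewrite (commute_shift_coord (tB i) k) leq_add2r.
  by rewrite subnDr.
(* Only the columns of [A] before [n0] enter the sum, so [T] itself serves; [B i] continues the
   first column of its class, the one of index [n0 + i]. *)
exists T, (fun i => toeplitz_of T (n0 + i)); split.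
- exact/lower_triangularP.
- move=> i; apply/analytic_toeplitzP/shift_commutantP.
  by split=> [l|k l]; rewrite !toeplitz_ofE// leq_addr.
- apply: bop_ext => l k; have [ln0|[i [j lE]]] := index_split l.
    by rewrite sum_op_pre.
  rewrite lE sum_op_per toeplitz_ofE//; last exact: leq_addr.
  case: leqP => [lk|kl]; last by rewrite lT.
  rewrite -(eventually_periodicX Tp j _ (leq_addr i n0)).
  by congr (l2_seq _ _); lia.
Qed.

(** The summands are supported on disjoint sets of columns, so each can be read off from the sum
    column by column. *)
Lemma direct_sum_toeplitz :
  direct_sum n0 p (lower_triangular R) (analytic_toeplitz R).
Proof.
move=> A B _ _ AB0; split=> [|i]; apply: bop_ext => l k; rewrite bop_mulE.
  rewrite proj_pre_basis; case: ifP => [ln0|_]; last by rewrite linear0.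
  by rewrite -(sum_op_pre A B ln0) AB0.
rewrite proj_per_basis; case: ifP => [/andP[n0l /eqP li]|_]; last by rewrite linear0.
have -> : (l = n0 + i + p * ((l - n0) %/ p))%N.
  by have := divn_eq (l - n0) p; rewrite li mulnC; lia.
by rewrite -(sum_op_per A) AB0.
Qed.

End LinearSumStructure.

(** * Orbit interpolation and the semicrossed product *)
Section OrbitInterpolation.
Variables (R : realType) (K : topologicalType).
Hypotheses (cK : compact [set: K]) (hK : hausdorff_space K).
Variables (phi : K -> K) (t : K) (n0 p : nat).
Hypotheses (hn0 : preperiod phi t n0) (hp : period phi (iter n0 phi t) p).

Lemma period_gt0 : (0 < p)%N. Proof. by case: hp => -[]. Qed.

Lemma orbit_addp n : (n0 <= n)%N -> iter (n + p) phi t = iter n phi t.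
Proof.
move=> /subnK <-; case: hp => -[_ pE] _.
by rewrite -addnA [(n0 + p)%N]addnC !iterD pE.
Qed.

(** A coincidence starting before [n0] would make an earlier point periodic; one inside the cycle
    would give a return time shorter than [p]. *)
Lemma orbit_inj i j : (i < n0 + p)%N -> (j < n0 + p)%N ->
  iter i phi t = iter j phi t -> i = j.
Proof.
wlog ij : i j / (i < j)%N.
  by move=> h ip jp E; case: (ltngtP i j) => // ij; [exact: h|apply/esym/h].
move=> _ jp E; have [in0|n0i] := ltnP i n0.
  have [_ /(_ i)] := hn0; rewrite leqNgt in0 => /(_ _)/Bool.diff_false_true [].
  exists (j - i)%N; split; first by rewrite subn_gt0.
  by rewrite -iterD subnK// ltnW.
(* Go from the first periodic point to index [i], identify it with index [j], then complete the
   cycle: a return after [p - (j - i)] steps. *)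
have [_ /(_ (p - (j - n0) + (i - n0))%N)] := hp.
have H : returns phi (iter n0 phi t) (p - (j - n0) + (i - n0))%N.
  split; first by lia.
  rewrite -iterD -addnA subnK// iterD E -iterD.
  rewrite (_ : p - (j - n0) + j = n0 + p)%N; last by lia.
  exact: orbit_addp.
by move=> /(_ H); lia.
Qed.

(** Finite sets are closed and [K] is normal, so Urysohn's lemma separates one orbit point from the
    others. These functions serve as a Lagrange basis on the orbit. *)
Lemma urysohn_orbit j : (j < n0 + p)%N -> exists2 u : K -> R, continuous u &
  forall i, (i < n0 + p)%N -> u (iter i phi t) = (i == j)%:R.
Proof.
move=> jp.
have /accessible_finite_set_closed cl := hausdorff_accessible hK.
pose A := (fun i => iter i phi t) @` [set i | (i < n0 + p)%N && (i != j)].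
have clA : closed A.
  apply: cl; apply: finite_image; apply: sub_finite_set (finite_II (n0 + p)).
  by move=> i /andP[].
have Aj : A `&` [set iter j phi t] = set0.
  apply/seteqP; split=> // x [[i /= /andP[ip ij] <-] /= E].
  by move/eqP: ij; apply; exact: orbit_inj E.
have sep := (@normal_separatorP R _).1 (compact_normal hK cK).
have [u [cu _ u0 u1]] := (@uniform_separatorP _ R _ _).1
  (sep _ _ clA (cl _ (finite_set1 _)) Aj).
exists u => // i ip; have [->|ij] := eqVneq i j.
  by apply: u1; exists (iter j phi t).
by apply: u0; exists (iter i phi t) => //; exists i => //=; rewrite ip.
Qed.

Lemma orbit_interpolation (c : nat -> R[i]) :
  (forall n, (n0 <= n)%N -> c (n + p)%N = c n) ->
  exists f : continuousType K R[i], forall n, f (iter n phi t) = c n.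
Proof.
move=> cp.
have /choice [u uP] (j : 'I_(n0 + p)) : exists u : K -> R, continuous u /\
    forall i, (i < n0 + p)%N -> u (iter i phi t) = (i == j)%:R.
  by have [u cu uE] := urysohn_orbit (ltn_ord j); exists u.
pose g x : R[i] := \sum_(j < n0 + p) c j * (u j x)%:C.
have cg : continuous g.
  move=> x; apply: cvg_big => [|j _]; first exact: (@add_continuous R[i]).
  apply: cvgM; first exact: cvg_cst.
  apply/cvg_normc; under eq_fun do rewrite -rmorphB normc_real.
  rewrite -(normr0 R); apply: cvg_norm; apply/subr_cvg0.
  by have [cu _] := uP j; exact: cu.
pose f : continuousType K R[i] := HB.pack g (isContinuous.Build _ _ g cg).
exists f => n; rewrite -[LHS]/(g (iter n phi t)).
(* Past the first [n0 + p] indices, both the orbit and [c] repeat with period [p], which reduces [n]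
   to [n - p]. *)
elim/ltn_ind: n => n ih; have [np|pn] := ltnP n (n0 + p).
  rewrite /g (bigD1 (Ordinal np))//= big1 ?addr0 => [|j jn].
    by have [_ ->] := uP (Ordinal np); rewrite //= eqxx mulr1.
  have [_ ->] := uP j; rewrite //.
  rewrite (_ : (n == j :> nat) = false) ?mulr0//.
  by rewrite eq_sym; apply/negbTE.
have np : (p <= n)%N by lia.
rewrite -(subnK np) orbit_addp ?cp; try lia.
by apply: ih; have := period_gt0; lia.
Qed.

End OrbitInterpolation.

(** * The matrix conditions define a w*-closed subspace *)

Section WeakStarSubspaces.
Context {R : realType}.
Local Notation bop := (bop R).
Local Notation e := (l2_basis R).
Local Notation v := (shift_op R).
Variables (n0 p : nat).

Let M := [set T : bop | lower_tri T /\ eventually_periodic n0 p T].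

Lemma closed_lower_periodic : closed M.
Proof.
rewrite (_ : M =
  (\bigcap_k \bigcap_(l in [set l | (k < l)%N]) [set T : bop | T (e l) k = 0]) `&`
  (\bigcap_k \bigcap_(l in [set l | (n0 <= l)%N])
     [set T : bop | T (e (l + p)%N) (k + p)%N = T (e l) k])).
  apply: closedI; apply: closed_bigI => k _; apply: closed_bigI => l _.
    exact: closed_coord_eq0.
  exact: closed_coord_eq.
apply/seteqP; split=> T [h1 h2]; split.
- by move=> k _ l; exact: h1.
- by move=> k _ l; exact: h2.
- by move=> k l; exact: h1.
- by move=> k l; exact: h2.
Qed.

Lemma subspace_lower_periodic : subspace_set M.
Proof.
split=> [|a S T]; rewrite !inE; first by split.
move=> [lS Sp] [lT Tp]; split=> k l kl.
  by rewrite -[LHS]/(a * S (e l) k + T (e l) k) lS// lT// mulr0 addr0.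
by rewrite -[LHS]/(a * S (e (l + p)%N) (k + p)%N + T (e (l + p)%N) (k + p)%N) Sp// Tp.
Qed.

End WeakStarSubspaces.

(** * Matrix description of the semicrossed product *)

Section SemicrossedProduct.
Variables (R : realType) (K : topologicalType).
Variables (cK : compact [set: K]) (hK : hausdorff_space K).
Variables (phi : K -> K) (t : K) (n0 p : nat).
Hypotheses (hn0 : preperiod phi t n0) (hp : period phi (iter n0 phi t) p).
Local Notation bop := (bop R).
Local Notation e := (l2_basis R).
Local Notation v := (shift_op R).

(** The diagonal operator acts before the shift, so the coefficient on the diagonal [k - l] is
    evaluated at the orbit point of the column index [l]. *)
Lemma semicrossed_polyE N (f : nat -> continuousType K R[i]) k l :
  semicrossed_poly cK phi t N f (e l) k =
    if (l <= k <= l + N)%N then f (k - l)%N (iter l phi t) else 0.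
Proof.
rewrite bop_sumE l2_sumE.
transitivity (\sum_(d < N.+1)
    if (k == l + d)%N then f d (iter l phi t) else 0).
  apply: eq_bigr => d _; rewrite bop_mulE shiftXE.
  case: leqP => [dk|kd]; last by case: eqP => // kld; move: kd; rewrite kld; lia.
  rewrite -[LHS]/(f d (iter (k - d) phi t) * (k - d == l)%N%:R).
  rewrite (_ : (k - d == l) = (k == l + d))%N; last by apply/eqP/eqP; lia.
  by case: eqP => [->|_]; rewrite ?mulr0// mulr1 addnK.
case: ifP => [/andP[lk kN]|lkN].
  have dN : (k - l < N.+1)%N by lia.
  rewrite (bigD1 (Ordinal dN))//= subnKC// eqxx big1 ?addr0// => d dk.
  by case: eqP => // kld; case/eqP: dk; apply: val_inj => /=; lia.
rewrite big1// => d _; case: eqP => // kld; move: lkN; rewrite kld.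
by have := ltn_ord d; lia.
Qed.

Lemma semicrossed_productP T : one_point_semicrossed_product R cK phi t T <->
  lower_tri T /\ eventually_periodic n0 p T.
Proof.
split=> [|[lT Tp]].
  move=> CT; apply: (@closed_lower_periodic R n0 p); apply: closure_subset CT.
  move=> U; apply; split; first exact: subspace_lower_periodic.
  move=> _ [N [f ->]]; split=> k l kl; rewrite !semicrossed_polyE.
    by rewrite leqNgt kl.
  by rewrite leq_add2r subnDr (orbit_addp hp)// addnAC leq_add2r.
(* The d-th subdiagonal of the Fejer mean, indexed by column; it inherits periodicity from [T] for
   [n >= n0], so a continuous function on [K] realizes it along the orbit. *)
pose c N d n : R[i] := (N.+1 - d)%:R / N.+1%:R * T (e n) (n + d)%N.
have /choice [f fE] (q : nat * nat) : exists f : continuousType K R[i],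
    forall n, f (iter n phi t) = c q.1 q.2 n.
  apply: (orbit_interpolation cK hK hn0 hp) => n n0n.
  by rewrite /c addnAC Tp.
pose S_ N := semicrossed_poly cK phi t N (fun d => f (N, d)).
have ST : S_ N @[N --> \oo] --> T.
  apply: fejer_cvg => // N k l; rewrite semicrossed_polyE fE /c /=.
  case: (leqP l k) => [lk|kl]; last by rewrite (lT k l kl) mulr0.
  rewrite subnKC//; case: leqP => // lN.
  by rewrite (_ : N.+1 - (k - l) = 0)%N ?mul0r//; lia.
apply: (closed_cvg _ (@closed_closure _ _) _ T ST); apply: nearW => N.
by apply: subset_closure => A [_ GA]; apply: GA; exists N, (fun d => f (N, d)).
Qed.

End SemicrossedProduct.

Theorem proposition3p1 (R : realType) (K : topologicalType)
  (cK : compact [set: K]) (hK : hausdorff_space K)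
  (phi : K -> K) (cphi : continuous phi) (t : K)
  (n0 p : nat) (hn0 : preperiod phi t n0) (hp : period phi (iter n0 phi t) p) :
  one_point_semicrossed_product R cK phi t =
    linear_sum n0 p (lower_triangular R) (analytic_toeplitz R)
  /\ direct_sum n0 p (lower_triangular R) (analytic_toeplitz R).
Proof.
have p0 := period_gt0 hp; split; last exact: direct_sum_toeplitz.
apply/seteqP; split=> T.
  by move=> /(semicrossed_productP cK hK hn0 hp) /(linear_sumP n0 p0).
by move=> /(linear_sumP n0 p0) /(semicrossed_productP cK hK hn0 hp).
Qed.
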